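(* Let $k$ be a field, let $d\geq 2$, and let $V_d$ be a $d$-dimensional $k$-vector space with a fixed basis $\mathcal{B}_d=\{e_1,\dots,e_d\}$. Let $(\Gamma_1,\dots,\Gamma_d)\in\mathcal{P}_d(K_{2d})$ be a $d$-partition of the complete graph $K_{2d}$. Then $(\Gamma_1,\dots,\Gamma_d)$ is cycle-free if and only if $det^{S^2}(f_{(\Gamma_1,\dots,\Gamma_d)})\neq 0$.
   Context: $K_{2d}$ is the complete graph on the vertex set $\{1,2,\dots,2d\}$; its edges are written $(s,t)$ with $1\leq s<t\leq 2d$. A $d$-partition of $K_{2d}$ is an ordered collection $(\Gamma_1,\dots,\Gamma_d)$ of subgraphs of $K_{2d}$ such that: $V(\Gamma_i)=V(K_{2d})$ for all $1\leq i\leq d$; $E(\Gamma_i)\cap E(\Gamma_j)=\emptyset$ for all $i\neq j$; and $\bigcup_{i=1}^d E(\Gamma_i)=E(K_{2d})$. The set of all $d$-partitions of $K_{2d}$ is denoted $\mathcal{P}_d(K_{2d})$. A $d$-partition is cycle-free if each $\Gamma_i$ is cycle-free (contains no cycle). To a $d$-partition $(\Gamma_1,\dots,\Gamma_d)$ one associates the element $f_{(\Gamma_1,\dots,\Gamma_d)}=(f_{s,t})_{1\leq s<t\leq 2d}\in V_d^{d(2d-1)}$ (equivalently the simple tensor $\otimes_{1\leq s<t\leq 2d}(f_{s,t})\in V_d^{\otimes d(2d-1)}$), where $f_{s,t}=e_i$ for the unique $i$ such that $(s,t)\in E(\Gamma_i)$. The map $det^{S^2}$ is defined as follows. Vectors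 of $V_d$ are written as column vectors in $k^d$ with respect to $\mathcal{B}_d$. Given a family $(v_{i,j})_{1\leq i<j\leq 2d}\in V_d^{d(2d-1)}$, for each $1\leq r\leq 2d$ let $M_r$ be the $d\times d(2d-1)$ matrix whose columns are indexed by the pairs $(i,j)$ with $1\le i<j\le 2d$, listed in the order $(1,2),(1,3),(2,3),(1,4),(2,4),(3,4),(1,5),\dots$ (ordered by $j$ first and then by $i$), where the column indexed by $(s,r)$ with $s<r$ is $(-1)^{s-1}v_{s,r}$, the column indexed by $(r,t)$ with $t>r$ is $(-1)^t v_{r,t}$, and all other columns are $0$. Let $A_1((v_{i,j})_{1\leq i<j\leq 2d})$ be the square $d(2d-1)\times d(2d-1)$ matrix obtained by stacking $M_2,M_3,\dots,M_{2d}$ on top of each other in this order. Then $det^{S^2}((v_{i,j})_{1\leq i<j\leq 2d})=\det\big(A_1((v_{i,j})_{1\leq i<j\leq 2d})\big)$. This map is multilinear, and the same symbol denotes the induced linear map on $V_d^{\otimes d(2d-1)}$. *)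

(* Defs.v *)
From mathcomp Require Import all_boot all_order all_algebra.
Set Implicit Arguments.
Unset Strict Implicit.
Unset Printing Implicit Defensive.
Import GRing.Theory.
Local Open Scope ring_scope.

(* Vertices of K_{2d} are the elements of 'I_(2 * d); the ordinal i stands for *)
(* the vertex labelled i + 1.                                                  *)
Definition edge (d : nat) :=
  {x : 'I_(2 * d) * 'I_(2 * d) | (x.1 < x.2)%N}.

(* Labels in {1, ..., 2d} of the two endpoints: src x < tgt x. *)
Definition src d (x : edge d) : nat := (val x).1.+1.
Definition tgt d (x : edge d) : nat := (val x).2.+1.

(* A subgraph of K_{2d} containing all the vertices is its set of edges. *)
Definition graph (d : nat) := {set edge d}.

Definition adj d (G : graph d) : rel 'I_(2 * d) := fun a b =>
  [exists x in G, (val x == (a, b)) || (val x == (b, a))].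

Definition cycle_free_graph d (G : graph d) : Prop :=
  forall c : seq 'I_(2 * d), (3 <= size c)%N -> ~ ucycle (adj G) c.

Definition is_dpartition d (Gamma : 'I_d -> graph d) : Prop :=
  (forall i j, i != j -> Gamma i :&: Gamma j = set0) /\
  \bigcup_i Gamma i = [set: edge d].

Definition cycle_free d (Gamma : 'I_d -> graph d) : Prop :=
  forall i, cycle_free_graph (Gamma i).

(* The edges in the order (1,2), (1,3), (2,3), (1,4), ...; insub discards the *)
(* pairs (i, j) with i >= j.                                                  *)
Definition edge_seq (d : nat) : seq (edge d) :=
  pmap insub [seq (i, j) | j <- enum 'I_(2 * d), i <- enum 'I_(2 * d)].

Lemma mem_edge_seq d (x : edge d) : x \in edge_seq d.
Proof.
rewrite mem_pmap_sub; apply/allpairsP; exists ((val x).2, (val x).1).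
by rewrite !mem_enum -surjective_pairing.
Qed.

Lemma edge_seq_uniq d : uniq (edge_seq d).
Proof.
apply: pmap_sub_uniq; apply: allpairs_uniq; rewrite ?enum_uniq //.
by move=> [a b] [a' b'] _ _ /= [-> ->].
Qed.

Lemma size_edge_seq d : size (edge_seq d) == (d * (2 * d - 1))%N.
Proof.
have -> : size (edge_seq d) = #|{: edge d}|.
  rewrite -(card_uniqP (edge_seq_uniq d)); apply: eq_card => x.
  by rewrite mem_edge_seq.
have -> : #|{: edge d}| = #|[pred x : 'I_(2 * d) * 'I_(2 * d) | (x.1 < x.2)%N]|.
  by rewrite card_sub.
rewrite -sum1_card -(pair_big_dep xpredT (fun i j : 'I_(2 * d) => (i < j)%N)
  (fun _ _ => 1%N)) /= (exchange_big_dep xpredT) //=.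
rewrite (eq_bigr (fun j : 'I_(2 * d) => j : nat)); last first.
  move=> j _; rewrite -(big_ord_widen _ (fun=> 1%N) (ltnW (ltn_ord j))).
  by rewrite sum1_card card_ord.
rewrite -(big_mkord xpredT (fun j => j)) bin2_sum bin2 -subn1 -mulnA mul2n.
by rewrite doubleK.
Qed.

Definition edges (d : nat) : (d * (2 * d - 1)).-tuple (edge d) :=
  Tuple (size_edge_seq d).

Section DetS2.
Variables (k : fieldType) (V : vectType k) (d : nat) (e : d.-tuple V).

(* f_(Gamma_1, ..., Gamma_d); the default 0 is never used for a d-partition. *)
Definition partition_family (Gamma : 'I_d -> graph d) (x : edge d) : V :=
  if [pick i | x \in Gamma i] is Some i then tnth e i else 0.

(* The block M_r, for a vertex label r; coordinates are taken in the basis e. *)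
Definition M_block (v : edge d -> V) (r : nat) : 'M[k]_(d, d * (2 * d - 1)) :=
  \matrix_(a, c)
    let x := tnth (edges d) c in
    coord e a (if tgt x == r then (-1) ^+ (src x - 1) *: v x
               else if src x == r then (-1) ^+ tgt x *: v x
               else 0).

Lemma stack_height : (\sum_(q < 2 * d - 1) d = d * (2 * d - 1))%N.
Proof. by rewrite sum_nat_const card_ord mulnC. Qed.

(* M_2, ..., M_{2d} on top of each other. *)
Definition A1 (v : edge d -> V) : 'M[k]_(d * (2 * d - 1)) :=
  castmx (stack_height, erefl) (\mxcol_(q < 2 * d - 1) M_block v q.+2).

Definition detS2 (v : edge d -> V) : k := \det (A1 v).

End DetS2.

(* Main.v *)
Require Import Defs.
From mathcomp Require Import all_boot all_order all_algebra.
Set Implicit Arguments.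
Unset Strict Implicit.
Unset Printing Implicit Defensive.
Import GRing.Theory.
Local Open Scope ring_scope.

(** After changes of sign, the matrix is made of incidence matrices of graphs.

    Write x = (s, t), s < t, for an edge of colour i, that is, of Gamma_i.
    In the coordinate e_i, the column of x has the entry (-1)^t in the block of
    s and (-1)^(s-1) in the block of t, and it vanishes elsewhere; the
    vertex 1 has no block.  Scaling the block of r by (-1)^r and the column of
    x by (-1)^(s+t) turns these entries into +1 at s and -1 at t.  So,
    after grouping rows and columns by colour, the matrix is block diagonal,
    and its i-th block is the oriented incidence matrix of
    Gamma_i without the row of the vertex 1.  Dropping this row loses nothing,
    because the rows of an incidence matrix add up to zero
    ([boundary_eq0]).

    A column vector in the kernel is therefore a family of circulations, one on
    each Gamma_i: weights on the edges whose signed sum at every vertex is zero.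
    The whole matrix is square, so its determinant vanishes exactly when some
    Gamma_i carries a nonzero circulation ([detS2_partition_eq0]).  Using the
    kernel of the whole matrix rather than the determinants of the blocks covers
    the case where some Gamma_i does not have 2d - 1 edges.

    It remains to see that a graph carries a nonzero circulation exactly when
    it contains a cycle.  The unit flow around a cycle is a circulation
    ([cycle_circulation]).  Conversely, a vertex cannot meet exactly one edge
    of the support of a circulation, so a walk inside the support never gets
    stuck and has to close up ([circulation_cycle],
    [ucycle_of_min_degree2]). *)

(** * Graphs and cycles *)

Lemma edge_neq d (x : edge d) : (val x).1 != (val x).2.
Proof. by rewrite neq_ltn (valP x). Qed.

Lemma edge_eq d (x x' : edge d) a b :
    (val x == (a, b)) || (val x == (b, a)) ->
    (val x' == (a, b)) || (val x' == (b, a)) ->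
  x = x'.
Proof.
have := valP x; have := valP x'.
move=> x'_lt x_lt /orP[]/eqP xE /orP[]/eqP x'E; apply: val_inj.
- by rewrite xE x'E.
- by move: x_lt x'_lt; rewrite xE x'E /= => /ltnW; rewrite leqNgt => /negPf->.
- by move: x_lt x'_lt; rewrite xE x'E /= => /ltnW; rewrite leqNgt => /negPf->.
- by rewrite xE x'E.
Qed.

Lemma adj_sym d (G : graph d) : symmetric (adj G).
Proof. by move=> a b; apply: eq_existsb => x; rewrite orbC. Qed.

Lemma adj_irr d (G : graph d) : irreflexive (adj G).
Proof.
move=> a; apply/existsP=> -[x /andP[_ /orP[]/eqP xE]];
  by have:= edge_neq x; rewrite xE eqxx.
Qed.

Lemma adj_edge d (G : graph d) (x : edge d) :
  adj G (val x).1 (val x).2 = (x \in G).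
Proof.
apply/existsP/idP=> [[y /andP[yG /orP[]]]|xG]; last first.
- by exists x; rewrite xG -surjective_pairing eqxx.
- have xlt := valP x; have ylt := valP y.
  by move/eqP=> yE; move: ylt; rewrite yE /= ltnNge (ltnW xlt).
- by rewrite -surjective_pairing => /eqP/val_inj <-.
Qed.

(** A path without repetition cannot be extended for ever.  If its end [x],
    reached from [y], has a neighbour other than [y], then either this
    neighbour is new and extends the path, or it lies on the path, at least two
    steps back, and closes a cycle of length at least 3. *)
Lemma ucycle_of_min_degree2 (T : finType) (e : rel T) (a b : T) :
    symmetric e -> irreflexive e -> e a b ->
    (forall x y, e x y -> exists2 z, e x z & z != y) ->
  exists2 c : seq T, (3 <= size c)%N & ucycle e c.
Proof.
move=> sym_e irr_e e_ab deg2.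
(* Paths are listed from their growing end [x]. *)
suff ext n : (exists2 c, 3 <= size c & ucycle e c)%N \/
    exists x y p, [/\ uniq [:: x, y & p], path e x (y :: p)
                    & size p = n].
  have [//|[x [y [p [p_uniq _ p_size]]]]] := ext #|T|.
  have := max_card [in [:: x, y & p]]; rewrite (card_uniqP p_uniq) /= p_size.
  by rewrite ltnNge leqnSn.
elim: n => [|n [|[x [y [p [p_uniq p_path p_size]]]]]]; [|by left|].
  right; exists a, b, [::]; split=> //=; last by rewrite e_ab.
  by rewrite inE andbT; apply: contraTneq e_ab => ->; rewrite irr_e.
have [z e_xz zNy] : exists2 z, e x z & z != y.
  by apply: deg2; case/andP: p_path.
have zNx : z != x by apply: contraTneq e_xz => ->; rewrite irr_e.
have [zp|zNp] := boolP (z \in p); last first.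
  right; exists z, x, (y :: p); split; last by rewrite /= p_size.
    by rewrite cons_uniq p_uniq !inE !negb_or zNx zNy zNp.
  by rewrite /= sym_e e_xz.
left; case/splitPr: zp p_uniq p_path {p_size} => p1 p2 p_uniq p_path.
exists [:: x, y & rcons p1 z]; first by rewrite /= size_rcons.
apply/andP; split; last first.
  by move: p_uniq; rewrite -cat_rcons -!cat_cons cat_uniq; case/and3P.
move: p_path; rewrite -cat_rcons -cat_cons cat_path => /andP[p_path _].
by rewrite (cycle_path x) /= last_rcons sym_e e_xz.
Qed.

(** * Circulations *)

Section Circulations.
Variables (k : fieldType) (d : nat).
Implicit Types (x : edge d) (v w : 'I_(2 * d)) (y : edge d -> k).

Definition incidence x v : k := ((val x).1 == v)%:R - ((val x).2 == v)%:R.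

Definition boundary y v : k := \sum_x incidence x v * y x.

Definition circulation (G : graph d) y : Prop :=
  (forall v, boundary y v = 0) /\ (forall x, x \notin G -> y x = 0).

Lemma incidence_eq0 x v :
  (incidence x v == 0) = ((val x).1 != v) && ((val x).2 != v).
Proof.
rewrite /incidence; have := edge_neq x.
case: ((val x).1 =P v) => [->|_]; case: ((val x).2 =P v) => [->|_] //=;
  by rewrite ?eqxx // ?subr0 ?sub0r ?oppr_eq0 ?oner_eq0 ?eqxx.
Qed.

Lemma sum_indic v : \sum_w ((v == w)%:R : k) = 1.
Proof.
by rewrite (bigD1 v) //= eqxx big1 ?addr0 // => w; rewrite eq_sym => /negPf->.
Qed.

Lemma sum_boundary y : \sum_v boundary y v = 0.
Proof.
rewrite exchange_big big1 // => x _.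
by rewrite -mulr_suml sumrB !sum_indic subrr mul0r.
Qed.

(** This is why the block of the vertex 1 can be left out of the matrix: the
    boundaries add up to zero, so the condition at one vertex follows from the
    conditions at the others. *)
Lemma boundary_eq0 y v0 :
  (forall v, v != v0 -> boundary y v = 0) -> forall v, boundary y v = 0.
Proof.
move=> y0 v; have [->|/y0//] := eqVneq v v0.
have := sum_boundary y; rewrite (bigD1 v0) //= big1 ?addr0 // => w; exact: y0.
Qed.

(** If an edge of the support meets [v], then the boundary at [v] can only
    vanish if another edge of the support meets [v] too, since an edge has a
    nonzero incidence number with each of its endpoints.  Hence all degrees in
    the support are 0 or at least 2, and the support contains a cycle. *)
Lemma circulation_cycle G y x0 :
  circulation G y -> y x0 != 0 -> ~ cycle_free_graph G.
Proof.
move=> [y_bd y_out] yx0 G_free.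
pose H : graph d := [set x | y x != 0].
have deg2 v w : adj H v w -> exists2 z, adj H v z & z != w.
  case/existsP=> x /andP[]; rewrite inE => yx xE.
  have x_v : incidence x v != 0.
    by rewrite incidence_eq0; case/orP: xE => /eqP->; rewrite eqxx ?andbF.
  have [x' /andP[x'x]] : exists x', (x' != x) && (incidence x' v * y x' != 0).
    apply/existsP; apply: contraNT (mulf_neq0 x_v yx) => /existsPn x'0.
    have := y_bd v; rewrite /boundary (bigD1 x) //= big1 ?addr0.
      by move=> ->.
    by move=> x' x'x; apply/eqP; have := x'0 x'; rewrite x'x /= negbK.
  rewrite mulf_eq0 negb_or incidence_eq0 negb_and !negbK => /andP[x'v yx'].
  have x'H : x' \in H by rewrite inE.
  case/orP: x'v => /eqP vE; [exists (val x').2 | exists (val x').1].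
  - by rewrite -vE adj_edge.
  - apply: contraNneq x'x => wE; apply/eqP/esym/(edge_eq xE).
    by rewrite [val x']surjective_pairing vE wE eqxx.
  - by rewrite -vE adj_sym adj_edge.
  - apply: contraNneq x'x => wE; apply/eqP/esym/(edge_eq xE).
    by rewrite [val x']surjective_pairing vE wE eqxx orbT.
have x0H : adj H (val x0).1 (val x0).2 by rewrite adj_edge inE.
have [c c_size /andP[c_cycle c_uniq]] :=
  ucycle_of_min_degree2 (@adj_sym _ H) (@adj_irr _ H) x0H deg2.
apply: (G_free c c_size); apply/andP; split=> //.
apply: sub_cycle c_cycle => v w /existsP[x]; rewrite inE => /andP[yx xE].
apply/existsP; exists x; rewrite xE andbT.
by apply: contraNT yx => /y_out->.
Qed.

Lemma sum_edge (F : 'I_(2 * d) * 'I_(2 * d) -> k) :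
  \sum_(x : edge d) F (val x) =
  \sum_(i < 2 * d) \sum_(j < 2 * d | (i < j)%N) F (i, j).
Proof.
rewrite (pair_big_dep xpredT (fun i j : 'I_(2 * d) => i < j)%N
  (fun i j => F (i, j))) /=.
rewrite [RHS](reindex_omap (val : edge d -> _) insub) /=.
  apply: eq_big => [x|x _]; first by rewrite (valP x) valK eqxx.
  by rewrite -surjective_pairing.
by move=> p p_lt; rewrite insubT.
Qed.

(** For a flow given by an antisymmetric function of ordered pairs, the
    boundary is the total flow out of [v], whatever the orientation of the
    edges.  The diagonal hypothesis does not follow from antisymmetry in
    characteristic 2. *)
Lemma boundary_antisym (g : 'I_(2 * d) -> 'I_(2 * d) -> k) v :
    (forall w, g w w = 0) -> (forall w z, g w z = - g z w) ->
  boundary (fun x => g (val x).1 (val x).2) v = \sum_w g v w.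
Proof.
move=> g_diag g_anti; rewrite [RHS](bigID (fun w : 'I_(2 * d) => (v < w)%N)) /=.
have -> : \sum_(w < 2 * d | ~~ (v < w)%N) g v w =
          \sum_(w < 2 * d | (w < v)%N) g v w.
  rewrite (bigD1 v) ?ltnn //= g_diag add0r; apply: eq_bigl => w.
  by rewrite -leqNgt ltn_neqAle andbC.
rewrite /boundary (sum_edge
  (fun p => ((p.1 == v)%:R - (p.2 == v)%:R) * g p.1 p.2)) /=.
under eq_bigr => i _ do
  under eq_bigr => j _ do rewrite mulrBl -mulrN -g_anti.
under eq_bigr => i _ do rewrite big_split /=.
rewrite big_split /=; congr (_ + _).
  rewrite (bigD1 v) //= [X in _ + X]big1 ?addr0.
    by apply: eq_bigr => w _; rewrite eqxx mul1r.
  by move=> i /negPf iNv; apply: big1 => j _; rewrite iNv mul0r.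
rewrite (exchange_big_dep xpredT) //= (bigD1 v) //= [X in _ + X]big1 ?addr0.
  by apply: eq_bigr => w _; rewrite eqxx mul1r.
by move=> i /negPf iNv; apply: big1 => j _; rewrite iNv mul0r.
Qed.

(** The circulation sends one unit along each step of the cycle.  It balances at
    every vertex because [next c] is a permutation with inverse [prev c], and
    it is nonzero because in a cycle of length at least 3 no edge is traversed
    in both directions. *)
Lemma cycle_circulation G (c : seq 'I_(2 * d)) :
    (3 <= size c)%N -> ucycle (adj G) c ->
  exists2 y, circulation G y & exists x, y x != 0.
Proof.
move=> c_size /andP[c_cycle c_uniq].
(* [next c] fixes the vertices outside [c], so the two terms cancel there. *)
pose g v w : k := (next c v == w)%:R - (next c w == v)%:R.
have next_adj v w : v != w -> next c v = w -> adj G v w.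
  move=> vNw vE; rewrite -vE; apply: next_cycle => //.
  by apply: contraNT vNw => vNc; rewrite -vE next_nth (negPf vNc).
exists (fun x => g (val x).1 (val x).2); first split.
- move=> v; rewrite boundary_antisym => [|w|w z]; first 1 last.
  + by rewrite /g subrr.
  + by rewrite /g opprB.
  rewrite sumrB sum_indic (eq_bigr (fun w => (prev c v == w)%:R)).
    by rewrite sum_indic subrr.
  move=> w _; congr (nat_of_bool _)%:R.
  by apply/eqP/eqP=> [<-|<-]; rewrite ?prev_next ?next_prev.
- move=> x; rewrite -adj_edge /g => xG.
  have -> : (next c (val x).1 == (val x).2) = false.
    by apply: contraNF xG => /eqP/next_adj->; rewrite ?edge_neq.
  rewrite (_ : (next c _ == _) = false) ?subrr //.
  by apply: contraNF xG => /eqP/next_adj; rewrite adj_sym eq_sym edge_neq => ->.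
case: c => [|a [|b [|b' c']]] // in c_size c_cycle c_uniq g next_adj *.
have ab : a != b by apply: contraTneq c_uniq => ->; rewrite /= inE eqxx.
have na : next [:: a, b, b' & c'] a = b by rewrite /= eqxx.
have nb : next [:: a, b, b' & c'] b = b' by rewrite /= eq_sym (negPf ab) eqxx.
have ab' : b' != a.
  by apply: contraTneq c_uniq => ->; rewrite /= !inE eqxx orbT.
have : g a b != 0 by rewrite /g na nb eqxx (negPf ab') subr0 oner_eq0.
have gC : g b a = - g a b by rewrite /g opprB.
case/existsP: (next_adj _ _ ab na) => x /andP[_ /orP[]/eqP xE] g0; exists x;
  by rewrite xE //= gC oppr_eq0.
Qed.

End Circulations.

(** * The kernel of the matrix *)

Section Kernel.
Variables (k : fieldType) (V : vectType k) (d : nat) (e : d.-tuple V).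
Hypothesis free_e : free e.
Variable Gamma : 'I_d -> graph d.
Hypothesis disj : forall i j, i != j -> Gamma i :&: Gamma j = set0.
Hypothesis cover_Gamma : \bigcup_i Gamma i = [set: edge d].

Lemma coord_partition_family i x :
    coord e i (partition_family e Gamma x) = (x \in Gamma i)%:R.
Proof.
rewrite /partition_family; case: pickP => [j xj|/(_ i)->]; last exact: linear0.
rewrite (tnth_nth 0) coord_free // eq_sym; congr (nat_of_bool _)%:R.
apply/eqP/idP=> [->//|xi]; apply/eqP; apply: contraTT isT => /disj/setP/(_ x).
by rewrite !inE xi xj.
Qed.

(** The sign is the column scaling that turns the matrix into incidence
    matrices. *)
Definition signed_col (y : edge d -> k) : 'cV[k]_(d * (2 * d - 1)) :=
  \col_c let x := tnth (edges d) c in (-1) ^+ (src x + tgt x) * y x.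

Lemma signed_col_surj (u : 'cV[k]_(d * (2 * d - 1))) :
  exists y, u = signed_col y.
Proof.
have inj_edges : injective (tnth (edges d)).
  exact/tuple_uniqP/edge_seq_uniq.
exists (fun x =>
  \sum_(c | tnth (edges d) c == x) (-1) ^+ (src x + tgt x) * u c 0).
apply/matrixP=> c z; rewrite ord1 !mxE /= (big_pred1 c).
  by rewrite mulrA -expr2 sqrr_sign mul1r.
by move=> c'; rewrite (inj_eq inj_edges).
Qed.

Lemma signed_col_eq0 y : (signed_col y == 0) = [forall x, y x == 0].
Proof.
apply/eqP/forallP=> [/matrixP y0 x|y0].
  have /tnthP[c ->] : x \in edges d by exact: mem_edge_seq.
  by have /eqP := y0 c 0; rewrite !mxE /= mulf_eq0 signr_eq0.
by apply/matrixP=> c z; rewrite !mxE /= (eqP (y0 _)) mulr0.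
Qed.

(** The vertex [v] has the label [v.+1].  The signs of the definition cancel
    against those of [signed_col]: at the smaller endpoint s of (s, t),
    (-1)^t (-1)^(s+t) = (-1)^s, and at the larger one
    (-1)^(s-1) (-1)^(s+t) = - (-1)^t. *)
Lemma M_block_signed_col y (v : 'I_(2 * d)) i :
  (M_block e (partition_family e Gamma) v.+1 *m signed_col y) i 0 =
  (-1) ^+ v.+1 * boundary (fun x => (x \in Gamma i)%:R * y x) v.
Proof.
rewrite mxE /boundary mulr_sumr.
rewrite [RHS](perm_big (edges d)); last first.
  apply: uniq_perm (index_enum_uniq _) (edge_seq_uniq d) _ => x.
  by rewrite mem_index_enum mem_edge_seq.
rewrite big_tuple; apply: eq_bigr => c _; rewrite !mxE /=.
set x := tnth _ _.
set b := (x \in Gamma i)%:R.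
have -> : coord e i
      (if tgt x == v.+1 then (-1) ^+ (src x - 1) *: partition_family e Gamma x
       else if src x == v.+1 then (-1) ^+ tgt x *: partition_family e Gamma x
       else 0)
    = (if tgt x == v.+1 then (-1) ^+ (src x - 1)
       else if src x == v.+1 then (-1) ^+ tgt x else 0) * b.
  do 2?case: ifP => _; rewrite ?linearZ ?linear0 /= ?mul0r //;
    by rewrite coord_partition_family.
rewrite mulrACA [RHS]mulrA; congr (_ * _); rewrite /incidence /src /tgt !eqSS.
rewrite -[(val x).1 == v]val_eqE -[(val x).2 == v]val_eqE /=.
have := edge_neq x; rewrite -val_eqE /= => x_neq.
have [jv|_] := eqVneq _ (v : nat); last first.
  have [->|_] := eqVneq _ (v : nat); last by rewrite subrr mulr0 mul0r.
  by rewrite subr0 mulr1 mulrC exprD -mulrA -expr2 sqrr_sign mulr1.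
move: x_neq; rewrite jv => /negPf->; rewrite sub0r mulrN1 subn1 /= exprD.
by rewrite mulrA exprS mulrCA -expr2 sqrr_sign mulr1 mulN1r.
Qed.

(** The kernel equations separate by colour, because the coordinate [i] only
    sees the edges of [Gamma i]. *)
Lemma A1_signed_col y :
  A1 e (partition_family e Gamma) *m signed_col y = 0 <->
  forall i v, boundary (fun x => (x \in Gamma i)%:R * y x) v = 0.
Proof.
have castmx_mul_eq0 m n p (E : m = n) (A : 'M[k]_(m, p)) (u : 'cV[k]_p) :
    castmx (E, erefl) A *m u = 0 <-> A *m u = 0.
  by case: n / E; rewrite castmx_id.
apply: iff_trans (castmx_mul_eq0 _ _ _ _ _ _) _; rewrite mxcol_mul.
split=> [/mxcolP y0 i|y0].
  case: (posnP (2 * d)) => [d0 v|d_gt0].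
    by have := ltn_ord v; rewrite {2}d0.
  apply: (@boundary_eq0 _ _ _ (Ordinal d_gt0)) => v.
  rewrite -val_eqE /= => v_neq0.
  have v_lt : (v.-1 < 2 * d - 1)%N by rewrite subn1 -ltnS !prednK // lt0n.
  have /matrixP/(_ i 0)/eqP := y0 (Ordinal v_lt).
  rewrite mxcolK submxcol0 /= prednK ?lt0n // M_block_signed_col mxE.
  by rewrite mulf_eq0 signr_eq0 => /eqP.
apply/mxcolP=> q; rewrite mxcolK submxcol0.
apply/matrixP=> i z; rewrite ord1 [RHS]mxE.
have q_lt : (q.+1 < 2 * d)%N by rewrite -[q.+1]add1n -ltn_subRL.
by have := M_block_signed_col y (Ordinal q_lt) i; rewrite y0 mulr0.
Qed.

(** A kernel vector restricts to a circulation on each [Gamma i], and one of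
    these is nonzero because every edge has a colour.  Conversely, a
    circulation on one [Gamma i] is a kernel vector since it vanishes on the
    other colours. *)
Lemma detS2_partition_eq0 :
  detS2 e (partition_family e Gamma) = 0 <->
  exists i, exists2 y : edge d -> k,
    circulation (Gamma i) y & exists x, y x != 0.
Proof.
rewrite /detS2 -det_tr.
split=> [/eqP/det0P[u u_neq0 uA]|[i [y [y_bd y_out] [x yx]]]].
  have [y uE] := signed_col_surj u^T.
  have /A1_signed_col y_bd :
      A1 e (partition_family e Gamma) *m signed_col y = 0.
    by apply: trmx_inj; rewrite -uE trmx_mul trmxK uA trmx0.
  have /forallPn[x yx] : ~~ [forall x, y x == 0].
    by rewrite -signed_col_eq0 -uE trmx_eq0.
  have /bigcupP[i _ xi] : x \in \bigcup_i Gamma i by rewrite cover_Gamma inE.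
  exists i, (fun x => (x \in Gamma i)%:R * y x).
    by split=> [|x' /negPf->]; [exact: y_bd | rewrite mul0r].
  by exists x; rewrite xi mul1r.
apply/eqP/det0P; exists (signed_col y)^T.
  by rewrite trmx_eq0 signed_col_eq0; apply/forallPn; exists x.
rewrite -trmx_mul (A1_signed_col y).2 ?trmx0 // => j v.
have [->|jNi] := eqVneq j i.
  rewrite -(y_bd v); apply: eq_bigr => x' _; congr (_ * _).
  by have [|/y_out->] := boolP (x' \in _); rewrite ?mul1r ?mulr0.
rewrite /boundary big1 // => x' _; have [x'j|_] := boolP (x' \in _).
  rewrite y_out ?mulr0 //; apply: contraTN isT => x'i.
  by have /setP/(_ x') := disj jNi; rewrite !inE x'i x'j.
by rewrite mul0r mulr0.
Qed.

End Kernel.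

Theorem theorem4p2 (k : fieldType) (d : nat) (hd : (2 <= d)%N)
    (V : vectType k) (e : d.-tuple V) (he : basis_of fullv e)
    (Gamma : 'I_d -> graph d) (hGamma : is_dpartition Gamma) :
  cycle_free Gamma <-> detS2 e (partition_family e Gamma) <> 0.
Proof.
have [disj cover] := hGamma; have free_e := basis_free he.
have det0E := detS2_partition_eq0 free_e disj cover.
split=> [G_free /det0E[i [y y_circ [x yx]]]|det_neq0 i c c_size c_cycle].
  exact: circulation_cycle y_circ yx (G_free i).
by apply/det_neq0/det0E; exists i; exact: cycle_circulation c_cycle.
Qed.
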